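(* Every tropical rational function $\varphi:\mathbb{R}\to\mathbb{R}$ in one variable has a unique minimal representation up to a linear function. Namely, if $\varphi=g_1\oslash h_1$ and $\varphi=g_2\oslash h_2$ are two minimal representations, then $g_1\oslash g_2=h_1\oslash h_2$ is a linear function. Moreover, a representation of $\varphi$ is minimal if and only if it is reduced.
   Context: A tropical polynomial in one variable is a function $g(x)=\max_{1\le i\le n}(b_ix+a_i)$ with $a_i,b_i\in\mathbb{R}$, given as a tropical sum of the monomials $b_ix+a_i$. It is reduced if removing any of its monomials changes the real-valued function. $g\oslash h$ denotes $g-h$. A tropical rational function is a function $\varphi=g\oslash h$ with $g,h$ tropical polynomials, and $g\oslash h$ is then a representation of $\varphi$; the representation is reduced if both $g$ and $h$ are reduced. ''Linear function'' means affine function. $\mathrm{mComp}(g)$ is the number of linear regions (affine pieces) of $g$. Representations of $\varphi$ are preordered by $g_1\oslash h_1\prec g_2\oslash h_2$ iff $\mathrm{mComp}(g_1)\le\mathrm{mComp}(g_2)$ and $\mathrm{mComp}(h_1)\le\mathrm{mComp}(h_2)$; a representation $g\oslash h$ is minimal if there is no representation $g'\oslash h'$ of $\varphi$ with $\mathrm{mComp}(g')\le\mathrm{mComp}(g)$, $\mathrm{mComp}(h')\le\mathrm{mComp}(h)$ and at least one strict inequality. (In one variable the paper does not distinguish monomial complexity from factorization complexity.)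
   Formalization: The last sentence fails as written: max(0,x) over itself is reduced but not minimal, and max(0,0) over 0 is minimal but not reduced. It is proved for g, h both reduced, with ''reduced'' representation also requiring that g and h share no non-affine tropical factor. *)

(* Defs.v *)
(* MathComp-Analysis. *)
From HB Require Import structures.
From mathcomp Require Import all_boot all_order all_algebra finmap.
From mathcomp Require Import all_classical all_reals all_analysis.

Set Implicit Arguments.
Unset Strict Implicit.
Unset Printing Implicit Defensive.

Import Order.TTheory GRing.Theory Num.Theory.
Import numFieldNormedType.Exports.

Local Open Scope classical_set_scope.
Local Open Scope ring_scope.

Section TropicalOneVariable.
Variable R : realType.

(* The pair (b, a) stands for the monomial x |-> b x + a; exponents are
   arbitrary real numbers.  The empty tropical sum is the tropical zero -oo. *)
Definition tsum (s : seq (R * R)) (x : R) : \bar R :=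
  \big[maxe/-oo%E]_(m <- s) (m.1 * x + m.2)%:E.

Record tpoly := TPoly {
  monomials : seq (R * R);
  monomials_neq0 : monomials != [::] }.

(* [fine] is harmless: [tsum s x] is finite when [s] is nonempty. *)
Definition teval (g : tpoly) (x : R) : R := fine (tsum (monomials g) x).
Coercion teval : tpoly >-> Funclass.

(* Monomials are removed by position, so that a repeated monomial is
   redundant; removing the only monomial yields -oo, hence a change. *)
Definition tpoly_reduced (g : tpoly) : Prop :=
  forall i, (i < size (monomials g))%N ->
    exists x, tsum (take i (monomials g) ++ drop i.+1 (monomials g)) x
              <> tsum (monomials g) x.

Definition affine_on (I : set R) (f : R -> R) : Prop :=
  exists b a : R, forall x, I x -> f x = b * x + a.

Definition affine_fun (f : R -> R) : Prop := affine_on setT f.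

(* The maximal intervals on which f is affine.  Maximality excludes the empty
   set, and also singletons when f is a tropical polynomial. *)
Definition linear_regions (f : R -> R) : set (set R) :=
  [set I | [/\ is_interval I, affine_on I f &
     forall J, is_interval J -> affine_on J f -> I `<=` J -> J = I]].

(* A tropical polynomial has finitely many linear regions; [fset_set] would
   be the empty finite set on an infinite set. *)
Definition mComp (g : tpoly) : nat := #|` fset_set (linear_regions g)|.

Definition represents (phi : R -> R) (g h : tpoly) : Prop :=
  forall x, phi x = g x - h x.

Definition tropical_rational (phi : R -> R) : Prop :=
  exists g h : tpoly, represents phi g h.

Definition minimal_rep (phi : R -> R) (g h : tpoly) : Prop :=
  represents phi g h /\
  ~ exists g' h' : tpoly,
      [/\ represents phi g' h',
          (mComp g' <= mComp g)%N, (mComp h' <= mComp h)%N &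
          (mComp g' < mComp g)%N \/ (mComp h' < mComp h)%N].

(* f divides g tropically: the tropical product of functions is their sum. *)
Definition tdivides (f g : tpoly) : Prop :=
  exists q : tpoly, forall x, g x = f x + q x.

(* The affine functions are the tropical units, so this says that nothing but
   units can be cancelled from the quotient of g by h. *)
Definition lowest_terms (g h : tpoly) : Prop :=
  forall f : tpoly, tdivides f g -> tdivides f h -> affine_fun f.

(* Reducedness of g and h alone does not prevent cancellation: max(0, x) over
   itself represents the zero function, as does 0 over 0, with fewer regions.
   A reduced representation is therefore also required to be in lowest terms. *)
Definition reduced_rep (g h : tpoly) : Prop :=
  [/\ tpoly_reduced g, tpoly_reduced h & lowest_terms g h].

End TropicalOneVariable.

(* Main.v *)
(* A tropical polynomial is determined up to an affine function by its kinks,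
   i.e. its jumps of slope: finitely many and positive. Conversely every
   piecewise affine function with nonnegative kinks is a tropical polynomial,
   and its number of linear regions is one more than its number of kinks. The
   difference kink g - kink h is determined by the quotient g - h. A kink common
   to g and h can be cancelled by subtracting a multiple of max(0, x - t), which
   removes it from g or from h; hence minimality and lowest terms both mean that
   g and h have disjoint kinks, so that g and h carry the positive and the
   negative kinks of the quotient. *)
Require Import Defs.
From mathcomp Require Import all_boot all_order all_algebra.
From mathcomp Require Import all_classical all_reals all_analysis.
From mathcomp Require Import finmap lra ring.

Set Implicit Arguments.
Unset Strict Implicit.
Unset Printing Implicit Defensive.

Import Order.TTheory GRing.Theory Num.Theory.

Local Open Scope classical_set_scope.
Local Open Scope ring_scope.

(** * Kinks of piecewise affine functions *)

Section Kinks.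
Variable R : realType.
Implicit Types (f g : R -> R) (t a b x y : R) (P : seq R).

(* A second difference rather than two one-sided slopes, so that kinks are
   visibly additive. *)
Definition has_kink f t k := exists2 e : R, 0 < e &
  forall d, 0 <= d <= e -> f (t + d) + f (t - d) - f t *+ 2 = k * d.

(** The default 0 is harmless for piecewise affine functions: by [pl_has_kink] they satisfy
    [has_kink] at every point. *)
Definition kink f t : R := xget 0 [set k | has_kink f t k].

(** Only the open interval has to avoid [P], while [f] is affine on the closed one; this builds in
    continuity at the breakpoints. [P] may be unsorted and may contain points where the slope does
    not change. *)
Definition pl_on P f := forall a b, a < b ->
  (forall p, p \in P -> ~~ (a < p < b)) ->
  affine_on [set x | a <= x <= b] f.

Definition piecewise_affine f := exists P, pl_on P f.

Definition hinge (c t : R) : R -> R := fun x => c * Num.max 0 (x - t).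

Lemma has_kink_unique f t k l : has_kink f t k -> has_kink f t l -> k = l.
Proof.
move=> [e e0 He] [e' e0' He'].
pose d := Num.min e e'.
have d0 : 0 < d by rewrite /d lt_min e0.
have de : d <= e by rewrite /d ge_min lexx.
have de' : d <= e' by rewrite /d ge_min lexx orbT.
have d0' := ltW d0.
have E : k * d = l * d by rewrite -He ?de ?d0' // -He' ?de' ?d0'.
by move/(mulIf (lt0r_neq0 d0)): E.
Qed.

Lemma kink_eq f t k : has_kink f t k -> kink f t = k.
Proof.
move=> fk; apply: (has_kink_unique _ fk).
by apply: (@xgetPex _ 0 [set k | has_kink f t k]); exists k.
Qed.

Lemma has_kinkB f g t k l :
  has_kink f t k -> has_kink g t l -> has_kink (fun x => f x - g x) t (k - l).
Proof.
move=> [e e0 He] [e' e0' He']; exists (Num.min e e') => [|d].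
  by rewrite lt_min e0.
rewrite le_min => /and3P[d0 de de'].
have := He d; have := He' d; rewrite d0 de de' => /(_ isT) E' /(_ isT) E.
by rewrite mulrBl -E -E'; ring.
Qed.

Lemma gap_around P t : exists2 e : R, 0 < e &
  forall p, p \in P -> ~~ (t < p < t + e) /\ ~~ (t - e < p < t).
Proof.
elim: P => [|p P [e e0 He]]; first by exists 1.
have [->|pt] := eqVneq p t.
  exists e => // q; rewrite in_cons => /predU1P[->|/He//].
  by split; apply/negP; lra.
exists (Num.min e `|p - t|) => [|q].
  by rewrite lt_min e0 normr_gt0 subr_eq0.
have h1 : Num.min e `|p - t| <= e by rewrite ge_min lexx.
have h2 : Num.min e `|p - t| <= `|p - t| by rewrite ge_min lexx orbT.
rewrite in_cons => /predU1P[->|/He[/negP n1 /negP n2]]; last first.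
  by split; apply/negP; lra.
by move: h2; case: (ger0P (p - t)) => _ h2; split; apply/negP; lra.
Qed.

Lemma affine_has_kink0 f t (u v : R) : u < t < v ->
  affine_on [set x | u <= x <= v] f -> has_kink f t 0.
Proof.
move=> /andP[ut tv] [c [c' H]].
exists (Num.min (t - u) (v - t)) => [|d].
  by rewrite lt_min !subr_gt0 ut.
rewrite le_min => /and3P[d0 h1 h2].
by rewrite !H /=; [ring|lra|lra|lra].
Qed.

Lemma pl_has_kink f t : piecewise_affine f -> has_kink f t (kink f t).
Proof.
case=> P fP; have [e e0 He] := gap_around P t.
have [||c [a H]] := fP t (t + e); [lra|by move=> p /He[]|].
have [||c' [a' H']] := fP (t - e) t; [lra|by move=> p /He[]|].
(* The kink is the slope on the right of [t] minus the slope on the left. *)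
suff hk : has_kink f t (c - c') by rewrite (kink_eq hk).
exists e => // d /andP[d0 de].
have E : f t = c * t + a by apply: H => /=; lra.
have E' : f t = c' * t + a' by apply: H' => /=; lra.
rewrite (H (t + d)) /=; last by lra.
rewrite (H' (t - d)) /=; last by lra.
by rewrite mulr2n {1}E E'; ring.
Qed.

Lemma sub_pl_on P Q f : {subset P <= Q} -> pl_on P f -> pl_on Q f.
Proof. by move=> PQ fP a b ab H; apply: fP => // p /PQ /H. Qed.

Lemma pl_onB P f g : pl_on P f -> pl_on P g -> pl_on P (fun x => f x - g x).
Proof.
move=> fP gP a b ab H.
have [c [d E]] := fP a b ab H; have [c' [d' E']] := gP a b ab H.
by exists (c - c'), (d - d') => x Ix; rewrite E // E' //; ring.
Qed.

Lemma piecewise_affineB f g : piecewise_affine f -> piecewise_affine g ->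
  piecewise_affine (fun x => f x - g x).
Proof.
move=> [P fP] [Q gQ]; exists (P ++ Q); apply: pl_onB.
  by apply: sub_pl_on fP => x; rewrite mem_cat => ->.
by apply: sub_pl_on gQ => x; rewrite mem_cat => ->; rewrite orbT.
Qed.

Lemma kinkB f g t : piecewise_affine f -> piecewise_affine g ->
  kink (fun x => f x - g x) t = kink f t - kink g t.
Proof. by move=> fP gP; apply/kink_eq/has_kinkB; exact: pl_has_kink. Qed.

Lemma affine_eq (b a b' a' u v : R) : u < v ->
  b * u + a = b' * u + a' -> b * v + a = b' * v + a' -> b = b' /\ a = a'.
Proof.
move=> uv E1 E2.
have : (b - b') * (v - u) = 0 by lra.
move/eqP; rewrite mulf_eq0 !subr_eq0 (gt_eqF uv) orbF => /eqP bb.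
by split => //; move: E1; rewrite bb => /addrI.
Qed.

(** Two points [u < v] of [I] determine the line. For [x] outside the segment from [u] to [v], the
    segment from [x] to the farther of the two contains both, so it carries the same line. *)
Lemma affine_on_pairs (I : set R) f :
  (forall x y, I x -> I y -> x < y -> affine_on [set z | x <= z <= y] f) ->
  affine_on I f.
Proof.
move=> H.
have [[u [v [Iu Iv uv]]]|nI] := pselect (exists u v, [/\ I u, I v & u < v]);
    last first.
  have [[u Iu]|I0] := pselect (exists u, I u); last first.
    by exists 0, 0 => x Ix; case: I0; exists x.
  exists 0, (f u) => x Ix; rewrite mul0r add0r.
  have [xu|ux|->//] := ltgtP x u; case: nI; first by exists x, u.
  by exists u, x.
have [b [a E]] := H u v Iu Iv uv; exists b, a => x Ix.
have [Eu Ev] : f u = b * u + a /\ f v = b * v + a.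
  by split; apply: E => /=; lra.
have [xu|ux] := ltP x u.
  have [|b' [a' E']] := H x v Ix Iv; first by lra.
  have [||<- <-] := affine_eq uv (b := b') (a := a') (b' := b) (a' := a).
  - by rewrite -Eu -E' //=; lra.
  - by rewrite -Ev -E' //=; lra.
  by apply: E' => /=; lra.
have [vx|xv] := ltP v x; last by apply: E => /=; lra.
have [|b' [a' E']] := H u x Iu Ix; first by lra.
have [||<- <-] := affine_eq uv (b := b') (a := a') (b' := b) (a' := a).
- by rewrite -Eu -E' //=; lra.
- by rewrite -Ev -E' //=; lra.
by apply: E' => /=; lra.
Qed.

Lemma pl_on_filter P f p : has_kink f p 0 -> pl_on P f ->
  pl_on [seq q <- P | q != p] f.
Proof.
move=> [e e0 He] fP a b ab H.
have HP q : q \in P -> q != p -> ~~ (a < q < b).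
  by move=> qP qp; apply: H; rewrite mem_filter qp.
have [/andP[ap pb]|napb] := boolP (a < p < b); last first.
  apply: fP => // q qP; have [->//|] := eqVneq q p; exact: HP.
have [|b1 [a1 E1]] := fP a p ap.
  by move=> q qP; have [->|/(HP _ qP)] := eqVneq q p; [|move/negP => ?];
    apply/negP; lra.
have [|b2 [a2 E2]] := fP p b pb.
  by move=> q qP; have [->|/(HP _ qP)] := eqVneq q p; [|move/negP => ?];
    apply/negP; lra.
pose d := Num.min e (Num.min (p - a) (b - p)).
have d0 : 0 < d by rewrite /d !lt_min e0 !subr_gt0 ap.
have [h1 h2 h3] : [/\ d <= e, d <= p - a & d <= b - p].
  by rewrite /d !ge_min !lexx !orbT.
have Ep1 : f p = b1 * p + a1 by apply: E1 => /=; lra.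
have Ep2 : f p = b2 * p + a2 by apply: E2 => /=; lra.
have Ed1 : f (p - d) = b1 * (p - d) + a1 by apply: E1 => /=; lra.
have Ed2 : f (p + d) = b2 * (p + d) + a2 by apply: E2 => /=; lra.
have Ed : f (p + d) + f (p - d) - f p *+ 2 = 0 * d by apply: He; lra.
have pd : p < p + d by lra.
(* The two lines agree at [p]; the vanishing second difference makes them agree at [p + d] as well,
   so they coincide. *)
have [||bb aa] := affine_eq pd (b := b2) (a := a2) (b' := b1) (a' := a1).
- by rewrite -Ep1.
- by lra.
exists b1, a1 => x /= /andP[ax xb].
have [xp|px] := leP x p; first by apply: E1 => /=; lra.
by rewrite -bb -aa; apply: E2 => /=; lra.
Qed.

Lemma pl_on_kinks P f : pl_on P f -> pl_on [seq p <- P | kink f p != 0] f.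
Proof.
move=> fP; have pf : piecewise_affine f by exists P.
(* Points without a kink are discarded one at a time. The induction runs over a separate list [Q] of
   candidates, with [P] fixed; [Q = P] gives the claim. *)
suff H (Q : seq R) : pl_on [seq p <- P | ~~ ((p \in Q) && (kink f p == 0))] f.
  apply: sub_pl_on (H P) => p; rewrite !mem_filter negb_and.
  by case: (p \in P); rewrite ?andbF.
elim: Q => [|q Q IH]; first by rewrite filter_predT.
have [q0|q0] := eqVneq (kink f q) 0.
  have hq : has_kink f q 0 by rewrite -q0; exact: pl_has_kink.
  apply: sub_pl_on (pl_on_filter hq IH) => p.
  rewrite !mem_filter in_cons; have [->|] := eqVneq p q => //=.
apply: sub_pl_on IH => p; rewrite !mem_filter in_cons.
by have [->|] := eqVneq p q => //=; rewrite (negbTE q0) !andbF.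
Qed.

Lemma no_kink_affine f : piecewise_affine f -> (forall t, kink f t = 0) ->
  affine_fun f.
Proof.
move=> [P /pl_on_kinks fP] k0; apply: affine_on_pairs => x y _ _ xy.
by apply: fP => // p; rewrite mem_filter k0 eqxx.
Qed.

Lemma affine_kink0 f t : affine_fun f -> kink f t = 0.
Proof.
move=> [b [a H]]; apply: kink_eq; apply: (@affine_has_kink0 _ _ (t - 1) (t + 1)).
  by lra.
by exists b, a => x _; exact: H.
Qed.

Lemma hinge_left c t x : x <= t -> hinge c t x = 0.
Proof. by move=> xt; rewrite /hinge max_l ?mulr0 // subr_le0. Qed.

Lemma hinge_right c t x : t <= x -> hinge c t x = c * (x - t).
Proof. by move=> xt; rewrite /hinge max_r // subr_ge0. Qed.

Lemma pl_on_hinge c t : pl_on [:: t] (hinge c t).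
Proof.
move=> a b ab /(_ t); rewrite mem_seq1 eqxx => /(_ isT) /negP nt.
have [ta|at_] := leP t a.
  exists c, (- (c * t)) => x /= /andP[ax xb].
  by rewrite hinge_right; [ring|lra].
exists 0, 0 => x /= /andP[ax xb]; rewrite hinge_left; first by ring.
by lra.
Qed.

Lemma piecewise_affine_hinge c t : piecewise_affine (hinge c t).
Proof. by exists [:: t]; exact: pl_on_hinge. Qed.

Lemma kink_hinge c t s : kink (hinge c t) s = if s == t then c else 0.
Proof.
apply: kink_eq; case: eqVneq => [->|st].
  exists 1 => // d /andP[d0 d1].
  rewrite hinge_right ?lerDl // hinge_left ?gerBl // hinge_left //.
  by ring.
have hP : pl_on [:: t] (hinge c t) by exact: pl_on_hinge.
have [st'|ts|E] := ltgtP s t; last by rewrite E eqxx in st.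
- apply: (@affine_has_kink0 _ _ (s - 1) t); first by lra.
  apply: hP => [|p]; first by lra.
  by rewrite mem_seq1 => /eqP ->; apply/negP; lra.
- apply: (@affine_has_kink0 _ _ t (s + 1)); first by lra.
  apply: hP => [|p]; first by lra.
  by rewrite mem_seq1 => /eqP ->; apply/negP; lra.
Qed.

End Kinks.

(** * Tropical polynomials as piecewise affine functions with nonnegative kinks *)

Section TropicalKinks.
Variable R : realType.
Implicit Types (f : R -> R) (g h : tpoly R) (t x y : R) (K P : seq R).

Lemma tsum_attained (s : seq (R * R)) x : s != [::] ->
  exists2 m, m \in s & tsum s x = (m.1 * x + m.2)%:E /\
    forall m', m' \in s -> m'.1 * x + m'.2 <= m.1 * x + m.2.
Proof.
elim: s => // m s IH _; rewrite /tsum big_cons -/(tsum s x).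
have [->|s0] := eqVneq s [::].
  exists m; first by rewrite mem_head.
  rewrite /tsum big_nil maxeNy; split=> // m'.
  by rewrite mem_seq1 => /eqP ->.
have [m0 m0s [-> ub]] := IH s0; rewrite -EFin_max.
have [le|lt] := leP (m.1 * x + m.2) (m0.1 * x + m0.2).
  exists m0; first by rewrite in_cons m0s orbT.
  by split=> // m'; rewrite in_cons => /predU1P[->//|/ub].
exists m; first by rewrite mem_head.
split=> // m'; rewrite in_cons => /predU1P[->//|/ub h].
exact: le_trans h (ltW lt).
Qed.

Lemma teval_attained g x : exists2 m, m \in monomials g &
  g x = m.1 * x + m.2.
Proof.
have [m mg [E _]] := tsum_attained x (monomials_neq0 g).
by exists m => //; rewrite /teval E.
Qed.

Lemma teval_ge g x m : m \in monomials g -> m.1 * x + m.2 <= g x.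
Proof.
have [m' _ [E ub]] := tsum_attained x (monomials_neq0 g).
by rewrite /teval E; exact: ub.
Qed.

Lemma teval_eq g x v : (forall m, m \in monomials g -> m.1 * x + m.2 <= v) ->
  (exists2 m, m \in monomials g & v = m.1 * x + m.2) -> g x = v.
Proof.
move=> ub [m mg vm]; apply/le_anti/andP; split.
  by have [m' /ub h ->] := teval_attained g x.
by rewrite vm; exact: teval_ge.
Qed.

(* The breakpoints are among the pairwise crossings of the monomials: away from
   these the monomials keep their order, so a single one attains the maximum. *)
Lemma piecewise_affine_tpoly g : piecewise_affine g.
Proof.
exists [seq (n.2 - m.2) / (m.1 - n.1) | m <- monomials g, n <- monomials g].
move=> a b ab H; pose x0 := (a + b) / 2.
have [m mg E] := teval_attained g x0.
exists m.1, m.2 => x /= /andP[ax xb]; apply: teval_eq; last by exists m.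
move=> n ng; rewrite leNgt; apply/negP => lt.
have le : n.1 * x0 + n.2 <= m.1 * x0 + m.2 by rewrite -E; exact: teval_ge.
pose d := m.1 - n.1.
have lt' : d * x < n.2 - m.2 by rewrite /d; lra.
have le' : n.2 - m.2 <= d * x0 by rewrite /d; lra.
have d0 : d != 0 by apply/eqP => d0; move: lt' le'; rewrite d0; lra.
pose z := (n.2 - m.2) / d.
have /negP : ~~ (a < z < b) by apply: H; apply/allpairsP; exists (m, n).
apply.
have ax0 : a < x0 by rewrite /x0; lra.
have x0b : x0 < b by rewrite /x0; lra.
have [dn|dp] := ltP d 0.
  have : x0 <= z by rewrite /z ler_ndivlMr // mulrC.
  have : z < x by rewrite /z ltr_ndivrMr // mulrC.
  by move=> *; lra.
have {}dp : 0 < d by rewrite lt_neqAle eq_sym d0.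
have : z <= x0 by rewrite /z ler_pdivrMr // mulrC.
have : x < z by rewrite /z ltr_pdivlMr // mulrC.
by move=> *; lra.
Qed.

(** A monomial attaining the maximum at [t] is a line below [g] that touches it at [t], so the
    second difference there is nonnegative. *)
Lemma kink_tpoly_ge0 g t : 0 <= kink g t.
Proof.
have [e e0 /(_ e)] := pl_has_kink t (piecewise_affine_tpoly g).
rewrite lexx ltW // => /(_ isT) E.
rewrite -(pmulr_lge0 _ e0) -E.
have [m mg ->] := teval_attained g t.
have := teval_ge (t + e) mg; have := teval_ge (t - e) mg.
by move=> *; lra.
Qed.

(** Induction on the breakpoints: subtracting a hinge of slope [kink f p] removes the breakpoint [p]
    and changes no other kink. Adding the hinge back is a tropical multiplication. *)
Lemma tpoly_of_kinks f : piecewise_affine f -> (forall t, 0 <= kink f t) ->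
  exists g, g = f :> (R -> R).
Proof.
move=> [P]; elim: P f => [|p P IH] f fP k0.
  have [b [a E]] : affine_fun f.
    by apply: affine_on_pairs => x y _ _ xy; exact: fP.
  exists (@TPoly _ [:: (b, a)] isT); apply/funext => x; apply: teval_eq => /=.
    by move=> m; rewrite mem_seq1 => /eqP -> /=; rewrite E.
  by exists (b, a); rewrite ?mem_head ?E.
set c := kink f p; pose f' x := f x - hinge c p x.
have pf : piecewise_affine f by exists (p :: P).
have ph := piecewise_affine_hinge c p.
have pf' : piecewise_affine f' by exact: piecewise_affineB.
have kf' t : kink f' t = kink f t - if t == p then c else 0.
  by rewrite kinkB // kink_hinge.
have f'P : pl_on P f'.
  have h0 : has_kink f' p 0.
    by have := pl_has_kink p pf'; rewrite kf' eqxx subrr.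
  have : pl_on [seq q <- p :: P | q != p] f'.
    apply: pl_on_filter h0 _; apply: pl_onB => //.
    apply: (@sub_pl_on _ [:: p]); last exact: pl_on_hinge.
    by move=> q; rewrite mem_seq1 => /eqP ->; rewrite mem_head.
  by apply: sub_pl_on => q; rewrite mem_filter in_cons => /andP[/negbTE->].
have [t|g Eg] := IH f' f'P.
  by rewrite kf'; case: eqVneq => [->|_]; rewrite ?subrr ?subr0.
(* These are the monomials of the tropical product of [g] and [max(0, c * (x - p))]. Since [0 <= c],
   the first copy dominates left of [p] and the second right of it. *)
pose s := monomials g ++
  [seq (m.1 + c, m.2 - c * p) | m <- monomials g].
have s0 : s != [::] by rewrite /s; case: (monomials g) (monomials_neq0 g).
exists (TPoly s0); apply/funext => x.
have -> : f x = g x + hinge c p x by rewrite Eg /f' subrK.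
have c0 : 0 <= c := k0 p.
have mem_s m : m \in s -> (m \in monomials g) \/
    exists2 n, n \in monomials g & m = (n.1 + c, n.2 - c * p).
  by rewrite mem_cat => /orP[|/mapP]; [left|right].
have [m mg Em] := teval_attained g x.
have [xp|/ltW px] := leP x p; apply: teval_eq => /=.
- have cx : c * (x - p) <= 0 by rewrite mulr_ge0_le0 // subr_le0.
  move=> n /mem_s[/(teval_ge x)|[n' /(teval_ge x) h ->]] /=.
    by rewrite hinge_left // addr0.
  by rewrite hinge_left // addr0; lra.
- by exists m; rewrite ?mem_cat ?mg // hinge_left // addr0.
- have cx : 0 <= c * (x - p) by rewrite mulr_ge0 // subr_ge0.
  move=> n /mem_s[/(teval_ge x)|[n' /(teval_ge x) h ->]] /=;
    rewrite hinge_right //; lra.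
- exists (m.1 + c, m.2 - c * p); last by rewrite /= hinge_right // Em; ring.
  by rewrite mem_cat; apply/orP; right; apply/mapP; exists m.
Qed.

Lemma kink_support f : piecewise_affine f -> exists K,
  [/\ uniq K, pl_on K f & forall t, (t \in K) = (kink f t != 0)].
Proof.
move=> [P fP]; exists (undup [seq p <- P | kink f p != 0]); split.
- exact: undup_uniq.
- by apply: sub_pl_on (pl_on_kinks fP) => t; rewrite mem_undup.
move=> t; rewrite mem_undup mem_filter andb_idr // => kt.
(* A point outside [P] has a neighbourhood free of [P], where [f] is affine. *)
apply: contraNT kt => tP; apply/eqP/kink_eq.
have [e e0 He] := gap_around P t.
apply: (@affine_has_kink0 _ _ _ (t - e) (t + e)); first by lra.
apply: fP => [|p pP]; first by lra.
have pt : p != t by apply: contraNneq tP => <-.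
have [/negP h1 /negP h2] := He p pP; apply/negP => h.
by have [] := ltgtP p t => *; [apply: h2|apply: h1|move/eqP: pt]; lra.
Qed.

(** * Counting linear regions by kinks *)

Local Notation nlt x K := (count (fun k : R => (k < x)%R) K).
Local Notation nle x K := (count (fun k : R => (k <= x)%R) K).

(* The linear region with j of the kinks in K to its left, counted without
   sorting K; a kink satisfies the condition for both adjacent regions. *)
Definition region K (j : nat) : set R :=
  [set x | (nlt x K <= j <= nle x K)%N].

Lemma count_lt_split K x y : x < y -> nlt y K =
  (nle x K + count (fun k => (x < k < y)%R) K)%N.
Proof.
move=> xy; elim: K => //= k K ->.
by have [kx|xk] := leP k x; rewrite /= ?(le_lt_trans kx xy) // addnCA.
Qed.

(** Translates the absence of kinks strictly between two points into the inequalities that define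
    [region]. *)
Lemma count_noncrossing K x y : x < y ->
  (nlt y K <= nle x K)%N =
  all (fun k => ~~ (x < k < y)%R) K.
Proof.
move=> xy; rewrite (count_lt_split _ xy) -{2}[count _ _]addn0 leq_add2l leqn0.
by rewrite all_predC has_count -eqn0Ngt.
Qed.

Lemma count_lt_le K x y : x <= y ->
  (nlt x K <= nle y K)%N.
Proof. by move=> xy; apply: sub_count => k /= /ltW /le_trans; apply. Qed.

(** Since both counts agree, the point is not itself in [K]: it lies in the interior of the region
    with index [j]. *)
Lemma count_between K (j : nat) : uniq K -> (j <= size K)%N ->
  exists2 x, nlt x K = j & nle x K = j.
Proof.
move=> uK jK; pose s := sort <=%R K.
have sK : perm_eq s K by exact/permEl/perm_sort.
(* The lower bound serves the induction along the sorted list: a point beyond the first element has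
   that element in both counts. The initial bound lies below the whole list. *)
suff [x _ [xj xj']] : exists2 x, head 0 s - 1 < x &
    nlt x s = j /\ nle x s = j.
  by exists x; [rewrite -xj|rewrite -xj']; exact: esym (seq.permP sK _).
have : path <%R (head 0 s - 1) s.
  have: sorted <%R s.
    by rewrite lt_sorted_uniq_le (perm_uniq sK) uK sort_le_sorted.
  by case: (s) => //= a l ->; rewrite andbT; lra.
move: jK; rewrite -(perm_size sK); move: (head 0 s - 1) => p.
elim: s p j {uK sK} => [|q s IH] p [|j] //=.
- by exists (p + 1) => //; lra.
- move=> _ /andP[pq qs]; exists ((p + q) / 2); first by lra.
  have H k : k \in q :: s -> (p + q) / 2 < k.
    have : all (> q) s by apply: order_path_min qs => a b c /lt_trans; apply.
    move=> /allP h; rewrite in_cons => /predU1P[->|/h]; lra.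
  have C (a : pred R) : {in q :: s, forall k, ~~ a k} ->
      count a (q :: s) = 0%N.
    by move=> h; apply/eqP; rewrite eqn0Ngt -has_count; apply/hasPn.
  by split; apply: C => k /H h; rewrite -?leNgt -?ltNge ?ltW.
- move=> js /andP[pq qs]; have [x qx [xj xj']] := IH q j js qs.
  by exists x; [exact: lt_trans qx|rewrite qx (ltW qx) xj xj'].
Qed.

Lemma linear_regionsE f K : uniq K -> pl_on K f ->
  (forall t, (t \in K) = (kink f t != 0)) ->
  linear_regions f = region K @` `I_(size K).+1.
Proof.
move=> uK fK kK.
have noncross I x y : is_interval I -> affine_on I f -> I x -> I y -> x < y ->
    all (fun k => ~~ (x < k < y)) K.
  move=> itv [b [a E]] Ix Iy xy; apply/allP => k; rewrite kK.
  apply: contraNN => xky; apply/eqP/kink_eq.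
  apply: (affine_has_kink0 xky); exists b, a => z /= h.
  by apply: E; apply: itv Ix Iy _ h.
have reg_itv j : is_interval (region K j).
  move=> x y /andP[_ jx] /andP[yj _] z /andP[xz zy]; apply/andP; split.
    by apply: leq_trans yj; apply: sub_count => k /= /lt_le_trans; apply.
  by apply: leq_trans jx _; apply: sub_count => k /= /le_trans; apply.
have reg_aff j : affine_on (region K j) f.
  apply: affine_on_pairs => x y /andP[_ jx] /andP[yj _] xy.
  apply: fK => // k; move: k; apply/allP.
  by rewrite -count_noncrossing // (leq_trans yj).
apply/seteqP; split=> [I [itv aff Imax]|_ [j /= jK <-]].
  (* The index of [I] is the largest number of kinks strictly to the left of one of its points. The
     alternative [j = 0] gives the maximum a starting value even for an empty [I]. *)
  pose Q j := j = 0%N \/ exists2 x, I x & nlt x K = j.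
  have exQ : exists j, `[< Q j >] by exists 0%N; apply/asboolP; left.
  have ubQ j : `[< Q j >] -> (j <= size K)%N.
    by move/asboolP => [->//|[x _ <-]]; exact: count_size.
  have [j /asboolP Qj jmax] := ex_maxnP exQ ubQ.
  exists j; first by rewrite /= ltnS; exact/ubQ/asboolP.
  apply: Imax => // x Ix; apply/andP; split.
    by apply: jmax; apply/asboolP; right; exists x.
  case: Qj => [->//|[x0 Ix0 <-]].
  have [/count_lt_le//|xx0] := leP x0 x.
  by rewrite count_noncrossing //; exact: noncross Ix Ix0 xx0.
split=> // J itv aff sub; apply/seteqP; split=> // y Jy.
have [x xj xj'] := count_between uK (jK : (j <= size K)%N).
(* From the interior point [x], the interval [J] cannot reach past a kink, as [f] is affine on it;
   so each of its points has index [j] too. *)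
have Jx : J x by apply: sub; rewrite /region /= xj xj' leqnn.
have [xy|yx|<-] := ltgtP x y; last by rewrite /region /= xj xj' leqnn.
- apply/andP; split; last by rewrite -xj; exact/count_lt_le/ltW.
  by rewrite -xj' count_noncrossing //; exact: noncross Jx Jy xy.
- apply/andP; split; first by rewrite -xj'; exact/count_lt_le/ltW.
  by rewrite -xj count_noncrossing //; exact: noncross Jy Jx yx.
Qed.

(** Distinct indices from 0 to [size K] give distinct regions, because the point of [count_between]
    belongs to the region of a single index. *)
Lemma card_linear_regions f K : uniq K -> pl_on K f ->
  (forall t, (t \in K) = (kink f t != 0)) ->
  #|` fset_set (linear_regions f)| = (size K).+1.
Proof.
move=> uK fK kK; rewrite (linear_regionsE uK fK kK); apply: card_fset_set.
apply: inj_card_eq => i j /set_mem; rewrite /= ltnS => iK _ E.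
have [x xi xi'] := count_between uK iK.
have : region K i x by rewrite /region /= xi xi' leqnn.
by rewrite E /region /= xi xi' -eqn_leq => /eqP.
Qed.

Lemma mComp_subset g h :
  (forall t, kink g t != 0 -> kink h t != 0) -> (mComp g <= mComp h)%N.
Proof.
move=> sub.
have [K [uK gK kK]] := kink_support (piecewise_affine_tpoly g).
have [L [uL hL kL]] := kink_support (piecewise_affine_tpoly h).
rewrite /mComp (card_linear_regions uK gK kK) (card_linear_regions uL hL kL).
by rewrite ltnS uniq_leq_size // => t; rewrite kK kL; exact: sub.
Qed.

Lemma mComp_proper g h t : (forall s, kink g s != 0 -> kink h s != 0) ->
  kink g t = 0 -> kink h t != 0 -> (mComp g < mComp h)%N.
Proof.
move=> sub gt0 ht.
have [K [uK gK kK]] := kink_support (piecewise_affine_tpoly g).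
have [L [uL hL kL]] := kink_support (piecewise_affine_tpoly h).
rewrite /mComp (card_linear_regions uK gK kK) (card_linear_regions uL hL kL).
(* Strictness comes from [t]: put in front of [K], it still gives a duplicate-free list contained in
   [L]. *)
rewrite ltnS -[(size K).+1]/(size (t :: K)) uniq_leq_size //=.
  by rewrite uK andbT kK gt0 eqxx.
by move=> s; rewrite in_cons kK kL => /predU1P[->|/sub].
Qed.

(** * Kinks of representations: minimality, cancellation and uniqueness *)

Lemma represents_kink phi g h t : represents phi g h ->
  kink phi t = kink g t - kink h t.
Proof.
move=> E; rewrite -kinkB; try exact: piecewise_affine_tpoly.
by congr kink; apply/funext.
Qed.

Definition disjoint_kinks g h := forall t, kink g t = 0 \/ kink h t = 0.

(** Where a competitor [g'] has no kink, [kink g t - kink h t = - kink h' t <= 0], and disjointness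
    forces [kink g t = 0]. So the kinks of [g] occur in every competitor, and likewise those of
    [h]. *)
Lemma minimal_disjoint_kinks phi g h :
  represents phi g h -> disjoint_kinks g h -> minimal_rep phi g h.
Proof.
move=> E dis; split=> // -[g' [h' [E' _ _ lt]]].
have Ek t : kink g t - kink h t = kink g' t - kink h' t.
  by rewrite -!(represents_kink t (phi := phi)).
suff [] : (mComp g <= mComp g')%N /\ (mComp h <= mComp h')%N.
  by move=> le1 le2; case: lt; rewrite ltnNge ?le1 ?le2.
by split; apply: mComp_subset => t; apply: contra_neq => k0;
  have := Ek t; have := kink_tpoly_ge0 g t; have := kink_tpoly_ge0 h t;
  have := kink_tpoly_ge0 g' t; have := kink_tpoly_ge0 h' t;
  case: (dis t); rewrite k0; lra.
Qed.

Lemma common_kink_cancel g h t : kink g t != 0 -> kink h t != 0 ->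
  exists2 c, 0 < c &
  exists g' h', [/\ g = (fun x => g' x + hinge c t x) :> (R -> R),
    h = (fun x => h' x + hinge c t x) :> (R -> R),
    forall s, kink g' s = kink g s - kink (hinge c t) s,
    forall s, kink h' s = kink h s - kink (hinge c t) s &
    kink g' t = 0 \/ kink h' t = 0].
Proof.
(* The smaller of the two kinks is the largest amount whose subtraction leaves both nonnegative, and
   it brings one of them to 0. *)
move=> gt ht; pose c := Num.min (kink g t) (kink h t).
have cg : c <= kink g t by rewrite /c ge_min lexx.
have ch : c <= kink h t by rewrite /c ge_min lexx orbT.
have c0 : 0 < c.
  by rewrite lt_min !lt_neqAle ![0 == _]eq_sym gt ht !kink_tpoly_ge0.
have sub (u : tpoly R) : c <= kink u t ->
    exists2 v : tpoly R, u = (fun x => v x + hinge c t x) :> (R -> R) &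
      forall s, kink v s = kink u s - kink (hinge c t) s.
  move=> cu; have pu := piecewise_affine_tpoly u.
  have ph := piecewise_affine_hinge c t.
  have [||v Ev] := @tpoly_of_kinks (fun x => u x - hinge c t x).
  - exact: piecewise_affineB.
  - move=> s; rewrite kinkB // kink_hinge; case: eqVneq => [->|_].
      by rewrite subr_ge0.
    by rewrite subr0 kink_tpoly_ge0.
  exists v => [|s]; first by apply/funext => x; rewrite Ev subrK.
  by rewrite Ev kinkB.
have [g' Eg kg] := sub g cg; have [h' Eh kh] := sub h ch.
exists c => //; exists g', h'; split=> //.
rewrite kg kh kink_hinge eqxx /c.
by case: (leP (kink g t) (kink h t)) => _; [left|right]; rewrite subrr.
Qed.

(** Cancelling a common kink preserves the quotient, creates no kink and removes one from [g] or
    from [h], which contradicts minimality. *)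
Lemma minimal_disjointP phi g h : represents phi g h ->
  minimal_rep phi g h <-> disjoint_kinks g h.
Proof.
move=> E; split; last exact: minimal_disjoint_kinks.
move=> [_ nmin] t.
have [|gt] := eqVneq (kink g t) 0; first by left.
have [|ht] := eqVneq (kink h t) 0; first by right.
have [c c0 [g' [h' [Eg Eh kg kh k0]]]] := common_kink_cancel gt ht.
case: nmin; exists g', h'.
have sub (u v : tpoly R) : kink v t != 0 ->
    (forall s, kink u s = kink v s - kink (hinge c t) s) ->
    forall s, kink u s != 0 -> kink v s != 0.
  move=> vt ku s; rewrite ku kink_hinge; case: (eqVneq s t) => [->//|_].
  by rewrite subr0.
have sg := sub _ _ gt kg; have sh := sub _ _ ht kh.
split; [|exact: mComp_subset|exact: mComp_subset|].
  by move=> x; rewrite E Eg Eh; ring.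
by case: k0 => k0; [left; exact: mComp_proper sg k0 gt
                   |right; exact: mComp_proper sh k0 ht].
Qed.

(** Descent on [mComp g + mComp h], which drops whenever a representation fails to be minimal. *)
Lemma exists_minimal_rep phi : tropical_rational phi ->
  exists g h, minimal_rep phi g h.
Proof.
move=> [g [h]]; have [n] := ubnP (mComp g + mComp h).
elim: n g h => // n IH g h lt E.
apply: contrapT => nmin; apply: (nmin); exists g, h; split=> //.
move=> [g' [h' [E' le1 le2 lt']]]; apply: nmin; apply: (IH g' h') => //.
rewrite -ltnS; apply: leq_trans lt; rewrite ltnS.
by case: lt' => lt'; [rewrite -addSn|rewrite -addnS]; exact: leq_add.
Qed.

(** A common kink yields a hinge dividing both [g] and [h], and a hinge is not affine. Conversely,
    the kinks of a common divisor are bounded by those of [g] and of [h], hence all vanish. *)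
Lemma lowest_terms_disjoint g h : lowest_terms g h <-> disjoint_kinks g h.
Proof.
split=> [low t|dis f [q Eq] [r Er]].
  have [|gt] := eqVneq (kink g t) 0; first by left.
  have [|ht] := eqVneq (kink h t) 0; first by right.
  have [c c0 [g' [h' [Eg Eh _ _ _]]]] := common_kink_cancel gt ht.
  have [||f Ef] := @tpoly_of_kinks (hinge c t).
  - exact: piecewise_affine_hinge.
  - by move=> s; rewrite kink_hinge; case: eqP => // _; exact: ltW.
  have : affine_fun f.
    by apply: low; [exists g'|exists h'] => x; rewrite Ef addrC ?Eg ?Eh.
  move/(affine_kink0 t); rewrite Ef kink_hinge eqxx => c00.
  by rewrite c00 ltxx in c0.
have pt := @piecewise_affine_tpoly.
have sub (u v : tpoly R) : (forall x, u x = f x + v x) ->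
    forall t, kink f t <= kink u t.
  move=> E t; rewrite -subr_ge0 -kinkB; [|exact: pt..].
  suff -> : (fun x => u x - f x) = v by exact: kink_tpoly_ge0.
  by apply/funext => x; rewrite E addrC addKr.
apply: no_kink_affine => [|t]; first exact: pt.
apply/le_anti; rewrite kink_tpoly_ge0 andbT.
by case: (dis t) => <-; [exact: sub Eq t|exact: sub Er t].
Qed.

(** In both representations the kink of the numerator is the positive part of [kink phi t], so the
    difference of the numerators has no kinks. *)
Lemma disjoint_kinks_unique phi g1 h1 g2 h2 :
  represents phi g1 h1 -> disjoint_kinks g1 h1 ->
  represents phi g2 h2 -> disjoint_kinks g2 h2 ->
  affine_fun (fun x => g1 x - g2 x).
Proof.
move=> E1 d1 E2 d2; have pt := @piecewise_affine_tpoly.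
apply: no_kink_affine => [|t]; first exact: piecewise_affineB.
rewrite kinkB //.
have := represents_kink t E1; rewrite (represents_kink t E2).
have := kink_tpoly_ge0 g1 t; have := kink_tpoly_ge0 h1 t.
have := kink_tpoly_ge0 g2 t; have := kink_tpoly_ge0 h2 t.
by case: (d1 t) => ->; case: (d2 t) => ->; lra.
Qed.

End TropicalKinks.

Theorem proposition17 (R : realType) (phi : R -> R)
    (Hphi : tropical_rational phi) :
  [/\ (exists g h : tpoly R, minimal_rep phi g h),
      (forall g1 h1 g2 h2 : tpoly R,
         minimal_rep phi g1 h1 -> minimal_rep phi g2 h2 ->
         (forall x, g1 x - g2 x = h1 x - h2 x) /\
         affine_fun (fun x => g1 x - g2 x)) &
      (forall g h : tpoly R,
         represents phi g h -> tpoly_reduced g -> tpoly_reduced h ->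
         (minimal_rep phi g h <-> reduced_rep g h))].
Proof.
split; first exact: exists_minimal_rep.
- move=> g1 h1 g2 h2 m1 m2; have [E1 _] := m1; have [E2 _] := m2; split.
    by move=> x; have := E1 x; have := E2 x; lra.
  apply: (disjoint_kinks_unique (phi := phi) (h1 := h1) (h2 := h2)) => //.
    exact/(minimal_disjointP E1).
  exact/(minimal_disjointP E2).
- move=> g h E rg rh.
  (* Minimality and lowest terms meet in the disjointness of kinks; [rg] and [rh] supply the rest of
     [reduced_rep]. *)
  rewrite (minimal_disjointP E) -lowest_terms_disjoint.
  by split=> [low|[]//]; split.
Qed.
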